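(* Let $V$ be a finite set (case $q=1$) or a finite-dimensional $\mathbb{F}_q$-vector space (case $q\ge 2$ a prime power), $n=\operatorname{rk}V$. For all $k\in\{0,\ldots,n\}$ and all $i\in\{0,\ldots,\min(k,n-k)\}$, $$(\bar V_i^{(k)})^\perp=\bar V_i^{(n-k)} ,$$ where $(\bar V_i^{(k)})^\perp=\{f^\perp\mid f\in\bar V_i^{(k)}\}$ is the set of dualized functions. In other words, $\deg(f^\perp)=\deg(f)$ for all $f:{V\brack k}\to\mathbb{R}$.
   Context: For $q=1$, ''subspaces'' of $V$ are subsets and $\operatorname{rk}U=\#U$; for $q\ge2$ they are $\mathbb{F}_q$-linear subspaces and $\operatorname{rk}U=\dim U$. $U\le W$ means inclusion. $\mathcal{L}(V)$ is the lattice of all subspaces of $V$ and ${V\brack k}$ the set of those of rank $k$. For a subspace $U$ of $V$, $\boldsymbol{x}_U^{(k)}$ is the characteristic function of $\{K\in{V\brack k}\mid U\le K\}$. For $i\in\{0,\ldots,\min(k,n-k)\}$, $\bar V_i^{(k)}\subseteq\mathbb{R}^{{V\brack k}}$ is the real span of $\{\boldsymbol{x}_I^{(k)}\mid I\in{V\brack i}\}$; these spaces form an increasing chain with $\bar V^{(k)}_{\min(k,n-k)}=\mathbb{R}^{{V\brack k}}$. The degree $\deg(f)$ of a non-zero $f:{V\brack k}\to\mathbb{R}$ is the smallest $t\in\{0,\ldots,\min(k,n-k)\}$ with $f\in\bar V_t^{(k)}$; $\deg(\boldsymbol 0)=-\infty$. Dualization: fix an anti-automorphism (order-reversing bijection)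 $U\mapsto U^\perp$ of $\mathcal{L}(V)$, e.g. $U\mapsto V\setminus U$ for $q=1$, or the orthogonal space with respect to a non-degenerate bilinear form for $q\ge2$. It maps ${V\brack k}$ bijectively onto ${V\brack n-k}$. The dualized function of $f:{V\brack k}\to\mathbb{R}$ is $f^\perp:{V\brack n-k}\to\mathbb{R}$ with $f^\perp(K^\perp)=f(K)$ for $K\in{V\brack k}$. (Here $(\cdot)^\perp$ applied to sets of functions is the element-wise dualization, not an orthogonal complement.) *)

(* Defs.v *)
From HB Require Import structures.
From mathcomp Require Import all_boot all_order all_algebra.
From mathcomp Require Import reals.

Set Implicit Arguments.
Unset Strict Implicit.
Unset Printing Implicit Defensive.

Import Order.TTheory GRing.Theory Num.Theory.
Local Open Scope ring_scope.

HB.instance Definition _ (F : finFieldType) (vT : vectType F) :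
  isCountable {vspace vT} := PCanIsCountable (can_pcan (@VectorInternalTheory.vs2mxK F vT)).
HB.instance Definition _ (F : finFieldType) (vT : vectType F) :
  isFinite {vspace vT} := CanIsFinite (@VectorInternalTheory.vs2mxK F vT).

(* The two cases q = 1 and q = #|F| >= 2 of the ambient space V. *)
Inductive ambient :=
  | SetAmbient of finType
  | VectAmbient (F : finFieldType) of vectType F.

Definition subspace (V : ambient) : finType :=
  match V with
  | SetAmbient T => {set T}
  | VectAmbient F vT => {vspace vT}
  end.

Definition subsp_le (V : ambient) : rel (subspace V) :=
  match V with
  | SetAmbient T => fun U W : {set T} => U \subset W
  | VectAmbient F vT => fun U W : {vspace vT} => (U <= W)%VS
  end.

Definition rk (V : ambient) : subspace V -> nat :=
  match V with
  | SetAmbient T => fun U : {set T} => #|U|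
  | VectAmbient F vT => fun U : {vspace vT} => \dim U
  end.

Definition full (V : ambient) : subspace V :=
  match V with
  | SetAmbient T => [set: T]
  | VectAmbient F vT => {:vT}%VS
  end.

Definition rank (V : ambient) : nat := rk (full V).

Record antiAut (V : ambient) := AntiAut {
  perp :> subspace V -> subspace V;
  perp_bij : bijective perp;
  perp_anti : forall U W : subspace V, subsp_le U W -> subsp_le (perp W) (perp U)
}.

Definition grass (V : ambient) (k : nat) : finType :=
  {U : subspace V | rk U == k}.

(* R^o makes this an R-vector space (as opposed to an additive group only). *)
Definition func (R : realType) (V : ambient) (k : nat) : vectType R :=
  {ffun grass V k -> R^o}.

Definition charf (R : realType) (V : ambient) (k : nat) (U : subspace V) :
    func R V k :=
  [ffun K : grass V k => (subsp_le U (val K))%:R : R^o].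

Definition Vbar (R : realType) (V : ambient) (k i : nat) : {vspace func R V k} :=
  <<[seq charf R k (val J) | J : grass V i]>>%VS.

(* None stands for -oo.  [find] returns the least t in {0..min(k, n - k)} with
   f in Vbar_t; the search always succeeds for k <= n, because
   Vbar_(min(k, n - k)) is the whole function space. *)
Definition deg (R : realType) (V : ambient) (k : nat) (f : func R V k) :
    option nat :=
  if f == 0 then None
  else Some (find (fun t => f \in Vbar R V k t)
                  (iota 0 (minn k (rank V - k)).+1)).

Section Rank.

Variable V : ambient.
Implicit Types U W : subspace V.

Lemma subsp_le_refl U : subsp_le U U.
Proof. by case: V U => [T|F vT] U /=. Qed.

Lemma subsp_le_full U : subsp_le U (full V).
Proof. by case: V U => [T|F vT] U /=; rewrite ?subsetT ?subvf. Qed.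

Lemma rk_le U W : subsp_le U W -> (rk U <= rk W)%N.
Proof.
by case: V U W => [T|F vT] U W /=; [exact: subset_leq_card | exact: dimvS].
Qed.

Lemma rk_eq U W : subsp_le U W -> rk U = rk W -> U = W.
Proof.
case: V U W => [T|F vT] U W /= UW e; apply/eqP.
  by rewrite eqEcard UW e /=.
by rewrite eqEdim UW e /=.
Qed.

Lemma subsp_cover U W : subsp_le U W -> (rk U < rk W)%N ->
  exists U', [/\ subsp_le U U', subsp_le U' W & rk U' = (rk U).+1].
Proof.
case: V U W => [T|F vT] U W /= UW lt.
  have /subsetPn[x xW xU] : ~~ (W \subset U).
    by apply/negP => /subset_leq_card; rewrite leqNgt lt.
  exists (x |: U); split; first exact: subsetUr.
    by rewrite subUset sub1set xW.
  by rewrite cardsU1 xU.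
have /subvPn[x xW xU] : ~~ (W <= U)%VS.
  by apply/negP => /dimvS; rewrite leqNgt lt.
exists (U + <[x]>)%VS; split; first exact: addvSl.
  by rewrite subv_add UW -memvE.
rewrite dimv_disjoint_sum.
  by rewrite dim_vline (_ : x != 0) ?addn1 //; apply: contraNneq xU => ->; rewrite mem0v.
apply/eqP; rewrite -subv0; apply/subvP => y /memv_capP[yU /vlineP[a ya]].
rewrite memv0 ya; have [->|a0] := eqVneq a 0; first by rewrite scale0r.
by case/negP: xU; rewrite -(scalerK a0 x) memvZ // -ya.
Qed.

Variable p : antiAut V.

Lemma rk_perp_chain m U W : subsp_le U W -> (rk W - rk U = m)%N ->
  (rk (p W) + m <= rk (p U))%N.
Proof.
elim: m U => [|m IH] U UW e.
  by rewrite addn0; apply/rk_le/perp_anti.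
have lt : (rk U < rk W)%N by rewrite -subn_gt0 e.
have [U' [UU' U'W rU']] := subsp_cover UW lt.
have e' : (rk W - rk U' = m)%N by rewrite rU' subnS e.
have := IH _ U'W e'; rewrite addnS => /leq_ltn_trans; apply.
have le := perp_anti p UU'.
rewrite ltn_neqAle rk_le // andbT; apply/eqP => h.
have /(bij_inj (perp_bij p)) E := rk_eq le h.
by move: rU'; rewrite E => /esym/eqP; rewrite -[X in _ == X]addn0 -addn1 eqn_add2l.
Qed.

Lemma exists_rk0 : exists Z : subspace V, rk Z = 0%N /\ forall U, subsp_le Z U.
Proof.
case: V => [T|F vT] /=.
  by exists (set0 : {set T}); rewrite /= cards0; split=> // U; exact: sub0set.
by exists (0%VS : {vspace vT}); rewrite /= dimv0; split=> // U; exact: sub0v.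
Qed.

Lemma rk_perp U : rk (p U) = (rank V - rk U)%N.
Proof.
have [Z [Z0 ZU]] := exists_rk0.
have h1 := rk_perp_chain (subsp_le_full U) erefl.
have h2 := rk_perp_chain (ZU U) erefl.
have h3 := rk_le (subsp_le_full (p Z)).
apply/eqP; rewrite eqn_leq; apply/andP; split; last first.
  by apply: leq_trans h1; rewrite leq_addl.
rewrite leq_subRL ?rk_le ?subsp_le_full //.
by apply: leq_trans h3; move: h2; rewrite Z0 subn0 addnC.
Qed.

End Rank.

Section Dual.

Variables (V : ambient) (p : antiAut V) (k : nat).

Lemma perpk_subproof (K : grass V k) : rk (p (val K)) == (rank V - k)%N.
Proof. by rewrite rk_perp (eqP (valP K)). Qed.

Definition perpk (K : grass V k) : grass V (rank V - k) :=
  exist _ (p (val K)) (perpk_subproof K).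

Hypothesis kn : (k <= rank V)%N.

Definition perp_inv (U : subspace V) : subspace V :=
  invF (bij_inj (perp_bij p)) U.

Lemma perpk_inv_subproof (K : grass V (rank V - k)) :
  rk (perp_inv (val K)) == k.
Proof.
have := rk_perp p (perp_inv (val K)); rewrite /perp_inv f_invF (eqP (valP K)).
set U := invF _ _ => e; have U_le := rk_le (subsp_le_full U).
by rewrite -[X in _ == X](subKn kn) e subKn.
Qed.

Definition perpk_inv (K : grass V (rank V - k)) : grass V k :=
  exist _ (perp_inv (val K)) (perpk_inv_subproof K).

Lemma perpkK : cancel perpk perpk_inv.
Proof. by move=> K; apply/val_inj; rewrite /= /perp_inv invF_f. Qed.

Lemma perpk_invK : cancel perpk_inv perpk.
Proof. by move=> K; apply/val_inj; rewrite /= /perp_inv f_invF. Qed.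

Definition dual (R : realType) (f : func R V k) : func R V (rank V - k) :=
  [ffun K : grass V (rank V - k) => f (perpk_inv K) : R^o].

Lemma dualE (R : realType) (f : func R V k) (K : grass V k) :
  dual f (perpk K) = f K.
Proof. by rewrite ffunE perpkK. Qed.

End Dual.

(* Main.v *)
From HB Require Import structures.
Require Import Defs.
From mathcomp Require Import boolp classical_sets reals.
From mathcomp Require Import all_boot all_order all_algebra all_field.

(** The dual of [x_I] is the indicator of the subspaces contained in
    [H = perp I], of rank [n - i], so everything reduces to showing that such an
    indicator lies in [Vbar_i].  This goes by induction on [i]: choose [H'] above
    [H] with [rk H' = rk H + 1].  For [K <= H'], the number of points (vectors,
    when [q >= 2]) of [K] outside [H] is [0] if [K <= H] and a non-zero constant
    [c] otherwise, hence
      [[K <= H] = [K <= H'] (1 - c^-1 \sum_(v \notin H) [v \in K])],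
    and multiplying by the indicator of [v \in K] maps [x_I] to [x_(I + <v>)],
    raising the degree by at most one. *)

Set Implicit Arguments.
Unset Strict Implicit.
Unset Printing Implicit Defensive.

Import Order.TTheory GRing.Theory Num.Theory.
Local Open Scope ring_scope.

(** * Points of a subspace, and how many lie outside a smaller one *)

Section Points.

(* [vT] is destructed because the canonical structure of [finvect_type vT] is
   convertible to [vT] only when [vT] is a constructor application. *)
Lemma card_finvect (F : finFieldType) (vT : vectType F) (U : {vspace vT}) :
  #|[pred v : finvect_type vT | (v : vT) \in U]| = (#|F| ^ \dim U)%N.
Proof.
have card_mem (W : {vspace finvect_type vT}) :
    #|[pred v : finvect_type vT | v \in W]| = (#|F| ^ \dim W)%N.
  by rewrite -card_vspace; apply: eq_card => v; rewrite inE.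
by case: vT U card_mem => T cT U; apply.
Qed.

(** For [q >= 2] these are all vectors rather than lines; zero does no harm, since the sums below
    run over points outside a subspace. *)
Definition point (V : ambient) : finType :=
  match V with
  | SetAmbient T => T
  | VectAmbient F vT => finvect_type vT
  end.

Definition pmem (V : ambient) : point V -> subspace V -> bool :=
  match V with
  | SetAmbient T => fun (v : T) (U : {set T}) => v \in U
  | VectAmbient F vT => fun (v : vT) (U : {vspace vT}) => v \in U
  end.

Definition adjoin (V : ambient) : subspace V -> point V -> subspace V :=
  match V with
  | SetAmbient T => fun (U : {set T}) (v : T) => v |: U
  | VectAmbient F vT => fun (U : {vspace vT}) (v : vT) => (U + <[v]>)%VS
  end.

Definition npoints (V : ambient) (r : nat) : nat :=
  match V with
  | SetAmbient T => r
  | VectAmbient F vT => #|F| ^ r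
  end.

Variable V : ambient.
Implicit Types (U W K H : subspace V) (v : point V).

Lemma adjoin_le U v W : subsp_le (adjoin U v) W = subsp_le U W && pmem v W.
Proof.
case: V U v W => [T|F vT] U v W /=; first by rewrite subUset sub1set andbC.
by rewrite subv_add -memvE.
Qed.

Lemma pmem_le U W v : subsp_le U W -> pmem v U -> pmem v W.
Proof.
case: V U W v => [T|F vT] U W v /=; first by move=> /subsetP; apply.
by move=> /subvP; apply.
Qed.

Lemma adjoin_id U v : pmem v U -> adjoin U v = U.
Proof.
case: V U v => [T|F vT] U v /= vU; first by apply/setUidPr; rewrite sub1set.
by apply/addv_idPl; rewrite -memvE.
Qed.

Lemma rk_adjoin U v : ~~ pmem v U -> rk (adjoin U v) = (rk U).+1.
Proof.
case: V U v => [T|F vT] U v /= vU; first by rewrite cardsU1 vU.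
rewrite dimv_disjoint_sum.
  rewrite dim_vline (_ : v != 0) ?addn1 //.
  by apply: contraNneq vU => ->; rewrite mem0v.
apply/eqP; rewrite -subv0; apply/subvP => y /memv_capP[yU /vlineP[a ya]].
rewrite memv0 ya; have [->|a0] := eqVneq a 0; first by rewrite scale0r.
by case/negP: vU; rewrite -(scalerK a0 v) memvZ // -ya.
Qed.

Lemma card_pmem U : #|[pred v | pmem v U]| = npoints V (rk U).
Proof.
case: V U => [T|F vT] U /=; first by apply: eq_card => x; rewrite inE.
exact: card_finvect.
Qed.

Lemma npoints_lt r s : (r < s)%N -> (npoints V r < npoints V s)%N.
Proof. by case: V => [T|F vT] //= rs; rewrite ltn_exp2l // finNzRing_gt1. Qed.

(** [M] is the intersection of [K] and [H]. Since [K] is not below [H], the two together generate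
    [H'], so modularity of the rank makes [M] lose exactly one rank from [K]. *)
Lemma hyperplane_section H H' K :
  subsp_le H H' -> rk H' = (rk H).+1 -> subsp_le K H' -> ~~ subsp_le K H ->
  exists M, [/\ rk K = (rk M).+1, subsp_le M K &
                forall v, pmem v M = pmem v K && pmem v H].
Proof.
case: V H H' K => [T|F vT] H H' K /= HH' rH' KH' nKH.
  exists (K :&: H); split; last by move=> v; rewrite inE.
    have KHH' : K :|: H = H'.
      apply/eqP; rewrite eqEcard subUset KH' HH' rH' /=.
      apply: proper_card; rewrite properE subsetUr /=.
      by apply: contra nKH => /(subset_trans (subsetUl _ _)).
    by apply/eqP; rewrite -(eqn_add2r #|H|) -cardsUI KHH' rH' !addSn addnC.
  exact: subsetIl.
exists (K :&: H)%VS; split; last by move=> v; rewrite memv_cap.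
  have KHH' : (K + H)%VS = H'.
    apply/eqP; rewrite eqEdim subv_add KH' HH' rH' /= ltnNge.
    apply: contra nKH => le; have /eqP -> : H == (K + H)%VS.
      by rewrite eqEdim addvSr.
    exact: addvSl.
  by apply/eqP; rewrite -(eqn_add2r (\dim H)) -dimv_sum_cap KHH' rH' !addSn addnC.
exact: capvSl.
Qed.

Lemma card_pmemD U W : subsp_le U W ->
  #|[pred v | pmem v W && ~~ pmem v U]| = (npoints V (rk W) - npoints V (rk U))%N.
Proof.
move=> UW; rewrite -!card_pmem; apply/esym/eqP.
rewrite -(cardID [pred v | pmem v U] [pred v | pmem v W]).
rewrite (@eq_card _ (predI _ _) [pred v | pmem v U]); last first.
  move=> v; rewrite !inE; apply/andP/idP => [[] //|vU].
  by split=> //; apply: pmem_le vU.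
by rewrite addKn; apply/eqP/eq_card => v; rewrite !inE andbC.
Qed.

End Points.

(** * Indicators of the subspaces below [H], and their degree *)

Section Degree.

Variables (R : realType) (V : ambient).
Implicit Types (U W H : subspace V) (v : point V).

Lemma span_linear_mem (A B : vectType R) (h : {linear A -> B}) (X : seq A)
    (W : {vspace B}) :
  {in X, forall x, h x \in W} -> forall f, f \in <<X>>%VS -> h f \in W.
Proof.
move=> hX f fX; rewrite -(lfunE h); apply: subvP (memv_img _ fX).
rewrite limg_span; apply/span_subvP => _ /mapP[x xX ->].
by rewrite lfunE hX.
Qed.

Lemma charf_Vbar k U : charf R k U \in Vbar R V k (rk U).
Proof.
by apply/memv_span/imageP; exists (exist _ U (eqxx (rk U)) : grass V (rk U)).
Qed.

Lemma Vbar_linear (k i : nat) (B : vectType R) (h : {linear func R V k -> B})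
    (W : {vspace B}) :
  (forall U, rk U = i -> h (charf R k U) \in W) ->
  forall f, f \in Vbar R V k i -> h f \in W.
Proof.
move=> hU; apply: span_linear_mem => _ /imageP[J _ ->].
exact/hU/eqP/(valP J).
Qed.

(** Averaging: every [K] of rank [k] above [U] has the same number [c] of points outside [U],
    non-zero as [i < k], and adjoining any of them to [U] stays below [K]. *)
Lemma Vbar_succ k i : (i < k)%N -> (Vbar R V k i <= Vbar R V k i.+1)%VS.
Proof.
move=> ik; apply/subvP; apply: (@Vbar_linear _ _ _ idfun) => U rU /=.
pose c := (npoints V k - npoints V i)%N.
have c0 : c%:R != 0 :> R by rewrite pnatr_eq0 -lt0n subn_gt0 npoints_lt.
have -> : charf R k U =
    c%:R^-1 *: \sum_(v | ~~ pmem v U) charf R k (adjoin U v).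
  apply/ffunP => K; rewrite !ffunE sum_ffunE.
  under eq_bigr do rewrite ffunE adjoin_le.
  have [UK|nUK] /= := boolP (subsp_le U (val K)); last first.
    by rewrite big1 // scaler0.
  rewrite -natr_sum -big_mkcondr sum1_card.
  rewrite (@eq_card _ _ [pred v | pmem v (val K) && ~~ pmem v U]); last first.
    by move=> v; rewrite unfold_in inE andbC.
  by rewrite card_pmemD // (eqP (valP K)) rU -/c /GRing.scale /= mulVf.
apply/memvZ/memv_suml => v vU.
by rewrite -rU -(rk_adjoin vU) charf_Vbar.
Qed.

Definition restr_point k v (f : func R V k) : func R V k :=
  [ffun K : grass V k => (pmem v (val K))%:R *: f K].

Lemma restr_point_linear k v : linear (@restr_point k v).
Proof.
move=> a f g; apply/ffunP => K; rewrite !ffunE scalerDr !scalerA.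
by rewrite mulrC.
Qed.

HB.instance Definition _ k v := GRing.isLinear.Build R (func R V k)
  (func R V k) _ (restr_point v) (@restr_point_linear k v).

Lemma restr_point_charf k v U :
  restr_point v (charf R k U) = charf R k (adjoin U v).
Proof.
apply/ffunP => K; rewrite !ffunE adjoin_le andbC.
by rewrite /GRing.scale /= -natrM mulnb.
Qed.

Lemma Vbar_restr_point k i v (f : func R V k) : (i < k)%N ->
  f \in Vbar R V k i -> restr_point v f \in Vbar R V k i.+1.
Proof.
move=> ik; apply: Vbar_linear => U rU /=; rewrite restr_point_charf.
have [vU|vU] := boolP (pmem v U); last by rewrite -rU -(rk_adjoin vU) charf_Vbar.
(* Here [v] lies in [U], so the rank stays [i] and the inclusion of consecutive spaces is needed. *)
by rewrite adjoin_id //; apply: subvP (Vbar_succ ik) _ _; rewrite -rU charf_Vbar.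
Qed.

Definition cocharf k H : func R V k :=
  [ffun K : grass V k => (subsp_le (val K) H)%:R : R^o].

Lemma subsp_le_trans U W H : subsp_le U W -> subsp_le W H -> subsp_le U H.
Proof.
by case: V U W H => [T|F vT] U W H /=; [exact: subset_trans|exact: subv_trans].
Qed.

(** Evaluate at [K]. Not below [H']: every term vanishes. Below [H]: no point of [K] is outside [H],
    so the sum is zero. Otherwise the sum equals the constant dividing it. *)
Lemma cocharf_step k H H' : (0 < k)%N -> subsp_le H H' -> rk H' = (rk H).+1 ->
  cocharf k H = cocharf k H' -
    (npoints V k - npoints V k.-1)%:R^-1 *:
      \sum_(v | ~~ pmem v H) restr_point v (cocharf k H').
Proof.
move=> k0 HH' rH'; set c := (_ - _)%N.
have c0 : c%:R != 0 :> R.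
  by rewrite pnatr_eq0 -lt0n subn_gt0 npoints_lt ?ltn_predL.
apply/ffunP => K; rewrite !ffunE sum_ffunE.
under eq_bigr do rewrite !ffunE.
rewrite -scaler_suml -natr_sum -big_mkcondr sum1_card.
have [KH'|nKH'] := boolP (subsp_le (val K) H'); last first.
  have /negbTE -> : ~~ subsp_le (val K) H.
    by apply: contra nKH' => KH; apply: subsp_le_trans HH'.
  by rewrite !scaler0 subr0.
have [KH|nKH] := boolP (subsp_le (val K) H).
  rewrite eq_card0 ?scale0r ?scaler0 ?subr0 // => v.
  by rewrite unfold_in; apply/negbTE/negP => /andP[/negP nvH /(pmem_le KH)].
(* The points of [K] outside [H] are those outside [M], of rank [k - 1], so there are [c] of
   them. *)
have [M [rM MK pM]] := hyperplane_section HH' rH' KH' nKH.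
rewrite (@eq_card _ _ [pred v | pmem v (val K) && ~~ pmem v M]); last first.
  by move=> v; rewrite unfold_in inE pM andbC; case: (pmem v (val K)).
have kM : k = (rk M).+1 by rewrite -rM (eqP (valP K)).
rewrite card_pmemD // (eqP (valP K)) (_ : rk M = k.-1); last by rewrite kM.
by rewrite -/c scalerA mulVf // scale1r subrr.
Qed.

Lemma cocharf_Vbar k i H : (i <= k)%N -> (rk H + i)%N = rank V ->
  cocharf k H \in Vbar R V k i.
Proof.
elim: i H => [|i IH] H ik; [rewrite addn0|] => rH.
  (* For [i = 0], [H] is the whole space, so its indicator is the constant 1, as is that of the
     subspaces above [Z]. *)
  have [Z [Z0 ZU]] := exists_rk0 V.
  rewrite (_ : cocharf k H = charf R k Z); first by rewrite -Z0 charf_Vbar.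
  apply/ffunP => K; rewrite !ffunE ZU (rk_eq (subsp_le_full H) rH).
  by rewrite subsp_le_full.
have lt : (rk H < rk (full V))%N by rewrite -/(rank V) -rH addnS ltnS leq_addr.
have [H' [HH' _ rH']] := subsp_cover (subsp_le_full H) lt.
have {IH} H'V : cocharf k H' \in Vbar R V k i.
  by apply: IH; [exact: ltnW | rewrite rH' addSnnS].
rewrite (cocharf_step _ HH' rH') ?(leq_ltn_trans _ ik) //.
apply: memvB; first exact: subvP (Vbar_succ ik) _ H'V.
by apply/memvZ/memv_suml => v _; exact: Vbar_restr_point.
Qed.

End Degree.

(** * Dualization as a linear bijection exchanging the two kinds of indicators *)

Section Duality.

Variables (R : realType) (V : ambient) (p : antiAut V).
Implicit Types U W : subspace V.

(* [antiAut] only asks for one implication; the converse comes from counting the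
   pairs [U <= W], on which [(U, W) |-> (p W, p U)] is an injective self-map. *)
Lemma perp_le U W : subsp_le (p W) (p U) = subsp_le U W.
Proof.
apply/idP/idP; last exact: perp_anti.
have p_inj := bij_inj (perp_bij p).
pose S := [set X : subspace V * subspace V | subsp_le X.1 X.2]%SET.
pose h (X : subspace V * subspace V) := (p X.2, p X.1).
have h_inj : injective h by move=> [a b] [c d] [/p_inj -> /p_inj ->].
have hS : (h @: S)%SET = S.
  apply/eqP; rewrite eqEcard card_imset // leqnn andbT.
  by apply/subsetP => _ /imsetP[X XS ->]; rewrite inE in XS; rewrite inE perp_anti.
move=> le; have : h (U, W) \in S by rewrite inE.
by rewrite -hS (mem_imset _ _ h_inj) inE.
Qed.

Variables (k : nat) (kn : (k <= rank V)%N).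

Lemma dual_linear : linear (@dual V p k kn R).
Proof. by move=> a f g; apply/ffunP => K; rewrite !ffunE. Qed.

HB.instance Definition _ := GRing.isLinear.Build R (func R V k)
  (func R V (rank V - k)) _ (@dual V p k kn R) dual_linear.

Lemma dual_charf U :
  dual p kn (charf R k U) = cocharf R (rank V - k) (p U).
Proof.
apply/ffunP => K; rewrite -(perpk_invK p kn K) dualE !ffunE /=.
by rewrite perp_le.
Qed.

Lemma dual_cocharf U :
  dual p kn (cocharf R k U) = charf R (rank V - k) (p U).
Proof.
apply/ffunP => K; rewrite -(perpk_invK p kn K) dualE !ffunE /=.
by rewrite perp_le.
Qed.

Lemma dual_inj : injective (@dual V p k kn R).
Proof.
by move=> f g fg; apply/ffunP => K; rewrite -(dualE p kn) fg dualE.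
Qed.

Lemma dual_Vbar i (f : func R V k) : (i <= rank V - k)%N ->
  f \in Vbar R V k i -> dual p kn f \in Vbar R V (rank V - k) i.
Proof.
move=> ik; apply: Vbar_linear => U rU /=; rewrite dual_charf cocharf_Vbar //.
by rewrite rk_perp rU subnK // (leq_trans ik) ?leq_subr.
Qed.

(** The image of a linear map is a subspace, so generators suffice: [charf] of [U] is the dual of
    [cocharf] of the preimage of [U] under [p], which has rank [n - i]. *)
Lemma Vbar_dual i (g : func R V (rank V - k)) : (i <= k)%N ->
  g \in Vbar R V (rank V - k) i ->
  exists2 f, f \in Vbar R V k i & dual p kn f = g.
Proof.
move=> ik gV.
have /memv_imgP[f fV ->] : g \in (linfun (@dual V p k kn R) @: Vbar R V k i)%VS.
  move: g gV; apply: (@Vbar_linear _ _ _ _ _ idfun) => U rU /=.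
  have pU : p (perp_inv p U) = U by rewrite /perp_inv f_invF.
  rewrite -pU -dual_cocharf -lfunE; apply/memv_img/cocharf_Vbar => //.
  have := rk_perp p (perp_inv p U); rewrite pU rU => ->.
  by rewrite subnKC // rk_le // subsp_le_full.
by exists f; rewrite ?lfunE.
Qed.

(** The converse uses injectivity; dualizing twice would land in rank [rank V - (rank V - k)], which
    is not convertible to [k]. *)
Lemma mem_dual_Vbar i (f : func R V k) : (i <= minn k (rank V - k))%N ->
  (dual p kn f \in Vbar R V (rank V - k) i) = (f \in Vbar R V k i).
Proof.
rewrite leq_min => /andP[ik ink]; apply/idP/idP; last exact: dual_Vbar.
by move=> /(Vbar_dual ik)[g gV /dual_inj <-].
Qed.

End Duality.

Local Open Scope classical_set_scope.

Theorem theorem5p3 (R : realType) (V : ambient) (p : antiAut V)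
    (k : nat) (kn : (k <= rank V)%N) :
  (forall i : nat, (i <= minn k (rank V - k))%N ->
     [set dual p kn f | f in [set f | f \in Vbar R V k i]] =
     [set g | g \in Vbar R V (rank V - k) i]) /\
  (forall f : func R V k, deg (dual p kn f) = deg f).
Proof.
split=> [i ik|f].
  apply/seteqP; split=> [_ [f fV <-]|g gV] /=; first by rewrite mem_dual_Vbar.
  move: ik; rewrite leq_min => /andP[ik _].
  by have [f fV <-] := Vbar_dual p kn ik gV; exists f.
rewrite /deg -(raddf0 (@dual V p k kn R)) (inj_eq (@dual_inj R V p k kn)).
(* As [n - (n - k) = k] and the minimum is symmetric, both searches run over the same range. *)
case: ifP => // _; congr Some; rewrite subKn // minnC.
apply: eq_in_find => t; rewrite mem_iota add0n ltnS => /andP[_ tk].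
exact: mem_dual_Vbar.
Qed.
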